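(* Assume that $g$ is $\gamma$-strongly convex with $\gamma>0$. Let $(x^k,y^k)$ be a sequence generated by the accelerated primal-dual algorithm with linesearch described in the context (using this $\gamma$), and let $(\hat x,\hat y)$ be a saddle point of $\min_{x\in X}\max_{y\in Y}\langle Kx,y\rangle+g(x)-f^*(y)$. With $\sigma_k=\beta_k\tau_k$ define $$s_N=\sum_{k=1}^N\sigma_k,\qquad X^N=\frac{\sigma_1\theta_1x^0+\sum_{k=1}^N\sigma_k\bar x^k}{\sigma_1\theta_1+s_N},\qquad Y^N=\frac{\sum_{k=1}^N\sigma_ky^{k+1}}{s_N}.$$ Then, as $N\to\infty$, $\|x^N-\hat x\|=O(1/N)$ and $\mathcal G_{\hat x,\hat y}(X^N,Y^N)=O(1/N^2)$.
   Context: Setting: $X,Y$ are finite-dimensional real inner product spaces with norms $\|\cdot\|=\sqrt{\langle\cdot,\cdot\rangle}$; $K\colon X\to Y$ is linear with adjoint $K^*$; $g\colon X\to(-\infty,+\infty]$ and $f^*\colon Y\to(-\infty,+\infty]$ are proper lower semicontinuous convex functions ($f^*$ is the Legendre–Fenchel conjugate of a convex lower semicontinuous function $f$). $g$ is $\gamma$-strongly convex if $g(x_2)-g(x_1)\ge\langle u,x_2-x_1\rangle+\frac\gamma2\|x_2-x_1\|^2$ for all $x_1,x_2\in X$, $u\in\partial g(x_1)$. For $(\hat x,\hat y)\in \operatorname{dom} g\times\operatorname{dom} f^*$ put $P_{\hat x,\hat y}(x)=g(x)-g(\hat x)+\langle K^*\hat y,x-\hat x\rangle$, $D_{\hat x,\hat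 y}(y)=f^*(y)-f^*(\hat y)-\langle K\hat x,y-\hat y\rangle$, and $\mathcal G_{\hat x,\hat y}(x,y)=P_{\hat x,\hat y}(x)+D_{\hat x,\hat y}(y)$ (primal-dual gap). The pair is a saddle point if $P_{\hat x,\hat y}\ge0$ on $X$ and $D_{\hat x,\hat y}\ge0$ on $Y$. It is assumed that a saddle point exists. $\operatorname{prox}_h(x)=\operatorname{argmin}_z\{h(z)+\frac12\|z-x\|^2\}$. The constants in $O(\cdot)$ do not depend on $N$ (they may depend on the problem, the initialization, the parameters and the saddle point). Algorithm. Initialization: choose $x^0\in X$, $y^1\in Y$, $\mu\in(0,1)$, $\tau_0>0$, $\beta_0>0$; set $\theta_0=1$. For $k=1,2,\dots$: 1. $x^k=\operatorname{prox}_{\tau_{k-1}g}(x^{k-1}-\tau_{k-1}K^*y^k)$ and $\beta_k=\beta_{k-1}(1+\gamma\tau_{k-1})$. 2. Choose any trial value $\tau_k\in\Bigl[\tau_{k-1}\sqrt{\tfrac{\beta_{k-1}}{\beta_k}},\ \tau_{k-1}\sqrt{\tfrac{\beta_{k-1}}{\beta_k}(1+\theta_{k-1})}\Bigr]$ and run the linesearch: 2.a. compute $\theta_k=\tau_k/\tau_{k-1}$, $\bar x^k=x^k+\theta_k(x^k-x^{k-1})$, $y^{k+1}=\operatorname{prox}_{\beta_k\tau_kf^*}(y^k+\beta_k\tau_kK\bar x^k)$; 2.b. if $\sqrt{\beta_k}\,\tau_k\|K^*y^{k+1}-K^*y^k\|\le\|y^{k+1}-y^k\|$, stop the linesearch (keeping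 the current $\tau_k,\theta_k,\bar x^k,y^{k+1}$); otherwise replace $\tau_k$ by $\mu\tau_k$ and return to 2.a. *)

(* Defs.v *)
From HB Require Import structures.
From mathcomp Require Import all_boot all_order all_algebra.
From mathcomp Require Import all_classical all_reals all_analysis.

Set Implicit Arguments.
Unset Strict Implicit.
Unset Printing Implicit Defensive.

Import Order.TTheory GRing.Theory Num.Theory.
Import numFieldNormedType.Exports.

Local Open Scope classical_set_scope.
Local Open Scope ring_scope.

(* A finite-dimensional real inner product space is a vectType V over the reals
   together with a positive definite symmetric bilinear form on V. *)
Notation inner_product V := {dot V for idfun}.

Section ConvexAnalysis.
Variables (R : realType) (V : vectType R) (ip : inner_product V).
Implicit Types (h : V -> \bar R) (x u z p : V).

Definition ipnorm x : R := Num.sqrt (ip x x).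

Definition effdom h : set V := [set x | (h x < +oo)%E].

Definition proper_fun h : Prop := (forall x, h x != -oo%E) /\ effdom h !=set0.

(* V carries no canonical topology, so this is lower semicontinuity for the
   metric induced by ipnorm. *)
Definition lsc h : Prop :=
  forall x (a : R), (a%:E < h x)%E ->
    exists2 e : R, 0 < e & forall z, ipnorm (z - x) < e -> (a%:E < h z)%E.

Definition cvx h : Prop :=
  forall x z (t : R), 0 < t < 1 ->
    (h (t *: x + (1 - t) *: z)%R <= t%:E * h x + (1 - t)%:E * h z)%E.

Definition conjugate h : V -> \bar R :=
  fun u => ereal_sup [set ((ip u z)%:E - h z)%E | z in [set: V]].

Definition subdifferential h x : set V :=
  [set u | forall z, (h x + (ip u (z - x))%:E <= h z)%E].

Definition strongly_convex (gamma : R) h : Prop :=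
  forall x1 x2 u, subdifferential h x1 u ->
    ((ip u (x2 - x1) + gamma / 2 * ipnorm (x2 - x1) ^+ 2)%:E <= h x2 - h x1)%E.

Definition argmin h : set V := [set p | forall z, (h p <= h z)%E].

(* The set of minimizers; it is a singleton when h is proper, convex and lsc. *)
Definition prox h x : set V :=
  argmin (fun z => h z + (2^-1 * ipnorm (z - x) ^+ 2)%:E)%E.

Definition scalef (t : R) h : V -> \bar R := fun z => (t%:E * h z)%E.

End ConvexAnalysis.

Definition is_adjoint (R : realType) (X Y : vectType R)
    (ipX : inner_product X) (ipY : inner_product Y) (K : X -> Y) (Ks : Y -> X) :=
  forall x y, ipY (K x) y = ipX x (Ks y).

Section SaddlePoint.
Variables (R : realType) (X Y : vectType R).
Variables (ipX : inner_product X) (ipY : inner_product Y).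
Variables (K : X -> Y) (Ks : Y -> X) (g : X -> \bar R) (fs : Y -> \bar R).
Variables (xh : X) (yh : Y).

Definition primal_gap (x : X) : \bar R :=
  (g x - g xh + (ipX (Ks yh) (x - xh))%:E)%E.

Definition dual_gap (y : Y) : \bar R :=
  (fs y - fs yh - (ipY (K xh) (y - yh))%:E)%E.

Definition pd_gap (x : X) (y : Y) : \bar R := (primal_gap x + dual_gap y)%E.

Definition saddle_point : Prop :=
  [/\ effdom g xh, effdom fs yh,
      forall x, (0 <= primal_gap x)%E & forall y, (0 <= dual_gap y)%E].

End SaddlePoint.

Section Algorithm.
Variables (R : realType) (X Y : vectType R).
Variables (ipX : inner_product X) (ipY : inner_product Y).
Variables (K : X -> Y) (Ks : Y -> X) (g : X -> \bar R) (fs : Y -> \bar R).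
Variables (gamma mu : R).

Section Linesearch.
(* taup = tau_(k-1), beta = beta_k, xp = x^(k-1), x = x^k, y = y^k *)
Variables (taup beta : R) (xp x : X) (y : Y).

Definition ls_candidate (tau theta : R) (xb : X) (yn : Y) : Prop :=
  [/\ theta = tau / taup,
      xb = x + theta *: (x - xp) &
      prox ipY (scalef (beta * tau) fs) (y + (beta * tau) *: K xb) yn].

Definition ls_stop (tau : R) (yn : Y) : Prop :=
  Num.sqrt beta * tau * ipnorm ipX (Ks yn - Ks y) <= ipnorm ipY (yn - y).

(* linesearch tau tau' theta' xb' yn': started from the trial value tau, the
   backtracking terminates and returns tau', theta', xb', yn'. *)
Inductive linesearch : R -> R -> R -> X -> Y -> Prop :=
| ls_accept tau theta xb yn :
    ls_candidate tau theta xb yn -> ls_stop tau yn ->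
    linesearch tau tau theta xb yn
| ls_backtrack tau theta xb yn tau' theta' xb' yn' :
    ls_candidate tau theta xb yn -> ~ ls_stop tau yn ->
    linesearch (mu * tau) tau' theta' xb' yn' ->
    linesearch tau tau' theta' xb' yn'.

End Linesearch.

(* Iteration k >= 1 appears with k.+1 in place of k.  The values y 0 and xb 0
   are not used. *)
Record apdal_sequence (x xb : nat -> X) (y : nat -> Y)
    (tau theta beta : nat -> R) : Prop := {
  apdal_tau0 : 0 < tau 0;
  apdal_beta0 : 0 < beta 0;
  apdal_theta0 : theta 0 = 1;
  apdal_x : forall k,
    prox ipX (scalef (tau k) g) (x k - tau k *: Ks (y k.+1)) (x k.+1);
  apdal_beta : forall k, beta k.+1 = beta k * (1 + gamma * tau k);
  apdal_linesearch : forall k, exists trial : R,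
    tau k * Num.sqrt (beta k / beta k.+1) <= trial
      <= tau k * Num.sqrt (beta k / beta k.+1 * (1 + theta k)) /\
    linesearch (tau k) (beta k.+1) (x k) (x k.+1) (y k.+1)
      trial (tau k.+1) (theta k.+1) (xb k.+1) (y k.+2)
}.

End Algorithm.

Section Averages.
Variables (R : realType) (X Y : vectType R).
Variables (x xb : nat -> X) (y : nat -> Y) (tau theta beta : nat -> R).

Definition sigma (k : nat) : R := beta k * tau k.

Definition sigma_sum (N : nat) : R := \sum_(1 <= k < N.+1) sigma k.

Definition avg_x (N : nat) : X :=
  (sigma 1 * theta 1 + sigma_sum N)^-1 *:
    ((sigma 1 * theta 1) *: x 0 + \sum_(1 <= k < N.+1) sigma k *: xb k).

Definition avg_y (N : nat) : Y :=
  (sigma_sum N)^-1 *: \sum_(1 <= k < N.+1) sigma k *: y k.+1.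

End Averages.

(* Main.v *)
(* Adding the optimality conditions of the two proximal steps (the one for x is
   used at step k - 1 with test points x_(k-1) and x_(k+1), and at step k with
   test point xh), the stopping rule of the linesearch absorbs the coupling term
   and the energy
   A_k = beta_k / 2 |x_k - xh|^2 + 1 / 2 |y_k - yh|^2 decreases by at least
   sigma_k ((1 + theta_k) P(x_k) - theta_k P(x_(k-1)) + D(y_(k+1))).  Summing,
   with Jensen's inequality for P and D, bounds A_N and s_N G(X^N, Y^N).  The sum
   starts at k = 2, because g may be infinite at x_0; this only changes the
   constant.  Backtracking occurs only if sqrt(beta_k) tau_k ||K|| > 1, and the
   smallest admissible trial value preserves sqrt(beta_k) tau_k; so that quantity
   is bounded below, sqrt(beta_k) grows linearly and s_N quadratically. *)

Require Import Defs.
From HB Require Import structures.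
From mathcomp Require Import all_boot all_order all_algebra.
From mathcomp Require Import all_classical all_reals all_analysis.
From mathcomp Require Import ring lra.
Set Implicit Arguments.
Unset Strict Implicit.
Unset Printing Implicit Defensive.

Import Order.TTheory GRing.Theory Num.Theory.
Import numFieldNormedType.Exports.

Local Open Scope classical_set_scope.
Local Open Scope ring_scope.

(** * Inner products in finite dimension: Cauchy-Schwarz and boundedness of linear maps *)

Section InnerProduct.
Variables (R : realType) (V : vectType R) (ip : inner_product V).
Implicit Types (u v w : V) (a : R).

Lemma ipC u v : ip u v = ip v u.
Proof. by rewrite hermC expr0 mul1r. Qed.

Lemma ipDl u v w : ip (u + v) w = ip u w + ip v w.
Proof. exact: linearDl. Qed.

Lemma ipZl a u w : ip (a *: u) w = a * ip u w.
Proof. exact: linearZl_LR. Qed.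

Lemma ipNl u w : ip (- u) w = - ip u w.
Proof. by rewrite -scaleN1r ipZl mulN1r. Qed.

Lemma ipBl u v w : ip (u - v) w = ip u w - ip v w.
Proof. by rewrite ipDl ipNl. Qed.

Lemma ip0l w : ip 0 w = 0.
Proof. by rewrite -(scale0r w) ipZl mul0r. Qed.

Lemma ipDr w u v : ip w (u + v) = ip w u + ip w v.
Proof. by rewrite ipC ipDl !(ipC w). Qed.

Lemma ipZr a w u : ip w (a *: u) = a * ip w u.
Proof. by rewrite ipC ipZl (ipC w). Qed.

Lemma ipBr w u v : ip w (u - v) = ip w u - ip w v.
Proof. by rewrite ipC ipBl !(ipC w). Qed.

Lemma ipNr w u : ip w (- u) = - ip w u.
Proof. by rewrite ipC ipNl (ipC w). Qed.

Lemma ip_suml n (s : 'I_n -> V) w : ip (\sum_i s i) w = \sum_i ip (s i) w.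
Proof.
by rewrite (big_morph (fun u => ip u w) (fun u v => ipDl u v w) (ip0l w)).
Qed.

Lemma ip_ge0 u : 0 <= ip u u.
Proof.
by have [->|u0] := eqVneq u 0; [rewrite ip0l | apply/ltW/neq0_dnorm_gt0].
Qed.

Lemma ip_eq0 u : ip u u = 0 -> u = 0.
Proof.
move=> uu; apply: contra_eq uu => u0.
by rewrite gt_eqF// (neq0_dnorm_gt0 (s := ip) u u0).
Qed.

Lemma ipnorm_ge0 u : 0 <= ipnorm ip u.
Proof. exact: sqrtr_ge0. Qed.

Lemma ipnorm_sqr u : ipnorm ip u ^+ 2 = ip u u.
Proof. exact: sqr_sqrtr (ip_ge0 u). Qed.

Lemma ipnorm0 : ipnorm ip 0 = 0.
Proof. by rewrite /ipnorm ip0l sqrtr0. Qed.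

(** The component of [u] orthogonal to [v] has nonnegative square; multiplying by [ip v v] gives the
    squared inequality. *)
Lemma ip_le_norm u v : ip u v <= ipnorm ip u * ipnorm ip v.
Proof.
have [->|v0] := eqVneq v 0.
  by rewrite ipC ip0l ipnorm0 mulr0.
have vv := neq0_dnorm_gt0 (s := ip) v v0.
have := ip_ge0 (u - (ip u v / ip v v) *: v).
rewrite !(ipBl, ipBr, ipZl, ipZr) (ipC v u) => H.
have {}H : ip u v ^+ 2 <= ip u u * ip v v.
  rewrite -subr_ge0; move: (mulr_ge0 (ltW vv) H).
  by set b := (X in 0 <= X -> _); have -> : b = ip u u * ip v v - ip u v ^+ 2
    by rewrite /b; field; rewrite gt_eqF.
apply: le_trans (ler_norm _) _.
by rewrite -sqrtr_sqr -sqrtrM ?ip_ge0// ler_wsqrtr.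
Qed.

Lemma abs_ip_le_norm u v : `|ip u v| <= ipnorm ip u * ipnorm ip v.
Proof.
rewrite ler_norml ip_le_norm andbT lerNl -ipNl; apply: le_trans (ip_le_norm _ _) _.
by rewrite /ipnorm ipNl ipC ipNl opprK.
Qed.

Lemma ipnormD u v : ipnorm ip (u + v) <= ipnorm ip u + ipnorm ip v.
Proof.
rewrite -ler_sqr ?nnegrE ?addr_ge0 ?ipnorm_ge0// ipnorm_sqr.
rewrite !(ipDl, ipDr) sqrrD !ipnorm_sqr (ipC v u).
have := ip_le_norm u v; lra.
Qed.

Lemma ipnormZ a u : ipnorm ip (a *: u) = `|a| * ipnorm ip u.
Proof.
by rewrite /ipnorm ipZl ipZr mulrA -expr2 sqrtrM ?sqr_ge0// sqrtr_sqr.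
Qed.

Lemma ipnorm_sum n (s : 'I_n -> V) :
  ipnorm ip (\sum_i s i) <= \sum_i ipnorm ip (s i).
Proof.
elim/big_ind2 : _ => [|p u q v pu qv|//]; first by rewrite ipnorm0.
exact: le_trans (ipnormD _ _) (lerD pu qv).
Qed.

(* The coordinates of u solve a linear system with the Gram matrix of the basis
   and the right-hand side (ip u b_j)_j, which is bounded by ipnorm u. *)
Lemma coord_le_norm (i : 'I_(\dim {:V})) :
  exists2 C : R, 0 <= C & forall u, `|coord (vbasis fullv) i u| <= C * ipnorm ip u.
Proof.
set b := vbasis fullv.
pose M := (\matrix_(j < \dim {:V}, k < \dim {:V}) ip b`_j b`_k).
have ipM (c : 'rV_(\dim {:V})) k : (c *m M) 0 k = ip (\sum_j c 0 j *: b`_j) b`_k.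
  by rewrite mxE ip_suml; apply: eq_bigr => j _; rewrite mxE ipZl.
(* A row [c] of the kernel of the Gram matrix gives a combination [v] orthogonal to every basis
   vector, hence to itself; so [v = 0], and freeness of the basis kills [c]. *)
have Mu : M \in unitmx.
  rewrite -row_free_unit -kermx_eq0; apply/eqP/row_matrixP => j; rewrite row0.
  set c := row j _.
  have cM : c *m M = 0 by apply/sub_kermxP/row_sub.
  pose v := \sum_j c 0 j *: b`_j.
  have v0 : v = 0.
    apply: ip_eq0; rewrite {2}/v ipC ip_suml big1// => k _.
    have vb0 : ip v b`_k = 0 by rewrite /v -ipM cM mxE.
    by rewrite ipZl ipC vb0 mulr0.
  apply/rowP => k; rewrite [RHS]mxE.
  have /freeP := basis_free (vbasisP fullv : basis_of _ b).
  by move=> /(_ (fun k => c 0 k) v0 k).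
exists (\sum_(k < \dim {:V}) ipnorm ip b`_k * `|invmx M k i|).
  by apply: sumr_ge0 => k _; rewrite mulr_ge0 ?ipnorm_ge0.
move=> u; pose c := \row_j coord b j u.
have uE : \sum_j c 0 j *: b`_j = u.
  rewrite [RHS](coord_vbasis (memvf u)); apply: eq_bigr => j _.
  by rewrite mxE.
have -> : coord b i u = (c *m M *m invmx M) 0 i by rewrite mulmxK// mxE.
rewrite mxE mulr_suml; apply: le_trans (ler_norm_sum _ _ _) _.
apply: ler_sum => k _; rewrite ipM uE normrM mulrAC ler_wpM2r// mulrC.
exact: abs_ip_le_norm.
Qed.

End InnerProduct.

(** Expand [y] in a basis and bound each coordinate. For the adjoint map this supplies the constant
    in the role of the operator norm in the linesearch; the added 1 makes it positive, so that it
    can be divided by. *)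
Lemma linear_le_norm (R : realType) (X Y : vectType R) (ipX : inner_product X)
    (ipY : inner_product Y) (T : {linear Y -> X}) :
  exists2 L : R, 0 < L & forall y, ipnorm ipX (T y) <= L * ipnorm ipY y.
Proof.
have /all_sig2[C C0 HC] i := cid2 (coord_le_norm ipY i).
pose b := vbasis (fullv : {vspace Y}).
have S0 : 0 <= \sum_(i < \dim {:Y}) C i * ipnorm ipX (T b`_i).
  by apply: sumr_ge0 => i _; rewrite mulr_ge0 ?ipnorm_ge0.
exists (1 + \sum_(i < \dim {:Y}) C i * ipnorm ipX (T b`_i)); first by rewrite ltr_wpDr.
move=> y; rewrite {1}(coord_vbasis (memvf y)) linear_sum.
apply: le_trans (ipnorm_sum _ _) _.
rewrite mulrDl mul1r ler_wpDl ?ipnorm_ge0// mulr_suml.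
apply: ler_sum => i _; rewrite linearZ ipnormZ mulrAC ler_wpM2r ?ipnorm_ge0//.
Qed.

(** * Proximal points and convexity *)

Section Convexity.
Variables (R : realType) (V : vectType R) (ip : inner_product V).
Implicit Types (h : V -> \bar R) (u v w z p : V).

Lemma effdom_fin_num h z : proper_fun h -> effdom h z -> h z \is a fin_num.
Proof. by move=> [hN _] hz; rewrite fin_numE hN lt_eqF. Qed.

Lemma effdomE h z : proper_fun h -> effdom h z -> h z = (fine (h z))%:E.
Proof. by move=> hp hz; rewrite fineK// effdom_fin_num. Qed.

Definition convex_on (D : set V) (phi : V -> R) := forall u v t, D u -> D v ->
  0 < t < 1 -> D (t *: u + (1 - t) *: v) /\
    phi (t *: u + (1 - t) *: v) <= t * phi u + (1 - t) * phi v.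

Lemma cvx_convex_on h : proper_fun h -> cvx h -> convex_on (effdom h) (fine \o h).
Proof.
move=> hp hc u v t hu hv t01; have := hc u v t t01.
rewrite (effdomE hp hu) (effdomE hp hv) -!EFinM -EFinD => H.
have huv : effdom h (t *: u + (1 - t) *: v) by apply: le_lt_trans H _; exact: ltry.
by split=> //; move: H; rewrite (effdomE hp huv) lee_fin.
Qed.

(** First-order optimality: compare [p] with [s z + (1 - s) p], use convexity, divide by [s] and let
    [s] tend to 0. *)
Lemma prox_variational h t w p : proper_fun h -> cvx h -> 0 < t ->
  prox ip (scalef t h) w p -> effdom h p /\
  forall z, effdom h z -> ip (w - p) (z - p) <= t * (fine (h z) - fine (h p)).
Proof.
move=> hp hc t0 hprox.
have hpp : effdom h p.
  case: (hp) => hN [z hz]; have := hprox z; rewrite /scalef (effdomE hp hz).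
  rewrite -EFinM -EFinD /effdom /= ltey; case: (h p) (hN p) => // _.
  by rewrite gt0_muley.
split=> // z hz.
set a := t * (fine (h z) - fine (h p)) - ip (w - p) (z - p).
set b := 2^-1 * ip (z - p) (z - p).
have b0 : 0 <= b by rewrite mulr_ge0 ?ip_ge0.
(* The limit is replaced by one value of [s]: if [a < 0], then [s = - a / (1 + b - a)] lies in (0,1)
   and makes [a + s * b] negative. *)
suff a0 s : 0 < s < 1 -> 0 <= a + s * b.
  rewrite -subr_ge0 -/a leNgt; apply/negP => aN.
  have d0 : 0 < 1 + b - a by lra.
  have /a0 : 0 < - a / (1 + b - a) < 1.
    by rewrite divr_gt0 ?oppr_gt0//= ltr_pdivrMr//; lra.
  have -> : a + - a / (1 + b - a) * b = a * (1 - a) / (1 + b - a).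
    by field; rewrite gt_eqF.
  rewrite leNgt => /negP; apply.
  by rewrite pmulr_llt0 ?invr_gt0// nmulr_rlt0//; lra.
move=> s01; have [hq] := cvx_convex_on hp hc hz hpp s01.
have := hprox (s *: z + (1 - s) *: p); rewrite /scalef.
rewrite (effdomE hp hpp) (effdomE hp hq) -!EFinM -!EFinD lee_fin !ipnorm_sqr /=.
have -> : s *: z + (1 - s) *: p - w = s *: (z - p) - (w - p).
  by rewrite scalerBl scale1r scalerBr opprB !addrA; congr (_ - _); rewrite addrAC.
rewrite -(opprB w p) [ip (- _) (- _)]ipNl [ip _ (- _)]ipC ipNl opprK.
rewrite {}/a; rewrite {}/b in b0 *; move: (w - p) (z - p) b0 => w' z' b0.
rewrite !(ipBl, ipBr, ipZl, ipZr) (ipC ip z' w').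
move=> H1 H2; have {}H2 := ler_wpM2l (ltW t0) H2.
have s0 : 0 < s by case/andP: s01.
by rewrite -(pmulr_rge0 _ s0); lra.
Qed.

(** The variational inequality says that [(w - p) / t] is a subgradient of [h] at [p], so strong
    convexity applies to it. *)
Lemma prox_strongly_convex h t w p (gamma : R) :
  proper_fun h -> cvx h -> strongly_convex ip gamma h -> 0 < t ->
  prox ip (scalef t h) w p -> forall z, effdom h z ->
  ip (w - p) (z - p) + t * (gamma / 2 * ip (z - p) (z - p)) <=
    t * (fine (h z) - fine (h p)).
Proof.
move=> hp hc hs t0 hprox; have [hpp hv] := prox_variational hp hc t0 hprox.
have hu : subdifferential ip h p (t^-1 *: (w - p)).
  move=> z; case: (hp) => hN _.
  case E : (h z) (hN z) => [r| |] // _; last by rewrite leey.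
  have hz : effdom h z by rewrite /effdom /= E ltry.
  rewrite (effdomE hp hpp) -EFinD lee_fin ipZl -lerBrDl.
  by rewrite ler_pdivrMl//; have := hv z hz; rewrite E.
move=> z hz; have := hs p z _ hu.
rewrite (effdomE hp hpp) (effdomE hp hz) lee_fin ipZl ipnorm_sqr /=.
by rewrite -(ler_pM2l t0) mulrDr mulrA divff ?gt_eqF// mul1r.
Qed.

(* The triples (a, u, b) form the cone over the epigraph of phi on D, so
   stability under addition is Jensen's inequality. *)
Definition perspective_epi (D : set V) (phi : V -> R) (a : R) (u : V) (b : R) :=
  0 <= a /\ exists v, [/\ D v, u = a *: v & a * phi v <= b].

Lemma perspective_epiZ D phi a v : 0 <= a -> D v ->
  perspective_epi D phi a (a *: v) (a * phi v).
Proof. by move=> a0 Dv; split=> //; exists v. Qed.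

Lemma perspective_epiD D phi a1 u1 b1 a2 u2 b2 : convex_on D phi ->
  perspective_epi D phi a1 u1 b1 -> perspective_epi D phi a2 u2 b2 ->
  perspective_epi D phi (a1 + a2) (u1 + u2) (b1 + b2).
Proof.
move=> cD [a10 [v1 [D1 -> H1]]] [a20 [v2 [D2 -> H2]]]; split; first exact: addr_ge0.
(* A zero weight is treated apart: the point of the other triple then serves, and no division by
   [a1 + a2] takes place. *)
have [a10'|a1N] := eqVneq a1 0.
  by exists v2; rewrite a10' !(scale0r, add0r); split=> //; move: H1; rewrite a10' mul0r; lra.
have [a20'|a2N] := eqVneq a2 0.
  by exists v1; rewrite a20' !(scale0r, addr0); split=> //; move: H2; rewrite a20' mul0r; lra.
have {a10 a1N}a10 : 0 < a1 by rewrite lt_def a1N.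
have {a20 a2N}a20 : 0 < a2 by rewrite lt_def a2N.
have a0 : 0 < a1 + a2 by exact: addr_gt0.
have [|D12 H] := cD v1 v2 (a1 / (a1 + a2)) D1 D2.
  by rewrite divr_gt0//= ltr_pdivrMr// mul1r ltrDl.
have E : 1 - a1 / (a1 + a2) = a2 / (a1 + a2) by field; rewrite gt_eqF.
have F c : (a1 + a2) * (c / (a1 + a2)) = c by field; rewrite gt_eqF.
exists (a1 / (a1 + a2) *: v1 + (1 - a1 / (a1 + a2)) *: v2); split=> //.
  by rewrite scalerDr !scalerA E !F.
move: H; rewrite E -(ler_pM2l a0) => /le_trans; apply.
by rewrite mulrDr ![_ * (_ * phi _)]mulrA !F lerD.
Qed.

End Convexity.

(** * Termination values of the linesearch and growth of the step parameters *)

Section Linesearch.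
Variables (R : realType) (X Y : vectType R).
Variables (ipX : inner_product X) (ipY : inner_product Y).
Variables (K : X -> Y) (Ks : Y -> X) (fs : Y -> \bar R) (mu L : R).
Hypotheses (mu01 : 0 < mu < 1) (L_gt0 : 0 < L).
Hypothesis Ks_le : forall y, ipnorm ipX (Ks y) <= L * ipnorm ipY y.
Hypothesis KsB : {morph Ks : u v / u - v}.

(** Induction on the backtracking. A rejected value [t] has [Num.sqrt b * t > 1 / L], as otherwise
    the bound on [Ks] forces the stopping rule; the last rejected value times [mu] is the accepted
    one. *)
Lemma linesearchP taup b xp x y t0 t th xb yn : 0 < b -> 0 < t0 ->
  linesearch ipX ipY K Ks fs mu taup b xp x y t0 t th xb yn ->
  [/\ 0 < t, t <= t0, ls_candidate ipY K fs taup b xp x y t th xb yn,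
      ls_stop ipX ipY Ks b y t yn & t = t0 \/ mu / L <= Num.sqrt b * t].
Proof.
move=> b0 + H; case/andP: mu01 => mu0 mu1.
elim: H => {t0 t th xb yn} [t th xb yn cand stop t0|t th xb yn t' th' xb' yn' cand stop _ IH t0].
  by split=> //; left.
have [|t'0 t't cand' stop' t'E] := IH; first by rewrite mulr_gt0.
split=> //; first by apply: le_trans t't _; rewrite ger_pMl// ltW.
right; case: t'E => [->|//].
rewrite mulrCA ler_pM2l// -[_^-1]mul1r ler_pdivrMr// leNgt; apply/negP => small.
apply: stop; rewrite /ls_stop -KsB.
have bt0 : 0 <= Num.sqrt b * t by rewrite mulr_ge0 ?sqrtr_ge0// ltW.
apply: le_trans (ler_wpM2l bt0 (Ks_le _)) _.
by rewrite mulrA ler_piMl ?ipnorm_ge0 ?ltW.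
Qed.

End Linesearch.

Lemma step_lower_bound (R : realType) (tau beta : nat -> R) (c : R) :
  (forall k, 0 < tau k) -> (forall k, 0 < beta k) -> 0 < c ->
  (forall k, tau k * Num.sqrt (beta k / beta k.+1) <= tau k.+1 \/
             c <= Num.sqrt (beta k.+1) * tau k.+1) ->
  exists2 r, 0 < r & forall k, r <= Num.sqrt (beta k) * tau k.
Proof.
move=> tau0 beta0 c0 H.
exists (Num.min c (Num.sqrt (beta 0%N) * tau 0%N)).
  by rewrite lt_min c0 mulr_gt0 ?sqrtr_gt0.
elim=> [|k IH]; first by rewrite ge_min lexx orbT.
have [Hk|Hk] := H k; last by rewrite ge_min Hk.
apply: le_trans IH _.
have s0 : 0 < Num.sqrt (beta k.+1) by rewrite sqrtr_gt0.
apply: le_trans (ler_wpM2l (ltW s0) Hk).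
rewrite (sqrtrM _ (ltW (beta0 k))) (sqrtrV (ltW (beta0 k.+1))).
rewrite [leRHS](_ : _ = Num.sqrt (beta k) * tau k)//.
by field; rewrite gt_eqF.
Qed.

Lemma sqrt_linear_growth (R : realType) (tau beta : nat -> R) (gamma r : R) :
  0 < gamma -> 0 < r -> (forall k, 0 < beta k) -> (forall k, 0 < tau k) ->
  (forall k, r <= Num.sqrt (beta k) * tau k) ->
  (forall k, beta k.+1 = beta k * (1 + gamma * tau k)) ->
  exists2 d, 0 < d & forall k, d * k.+1%:R <= Num.sqrt (beta k).
Proof.
move=> gamma0 r0 beta0 tau0 Hr betaS.
have s0 k : 0 < Num.sqrt (beta k) by rewrite sqrtr_gt0.
have sE k : Num.sqrt (beta k) ^+ 2 = beta k by rewrite sqr_sqrtr ?ltW.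
pose d := Num.min (Num.sqrt (beta 0%N)) (gamma * r / 3).
have d0 : 0 < d by rewrite lt_min s0/= divr_gt0 ?mulr_gt0.
(* With [s = Num.sqrt (beta k)], the recursion gives [beta k.+1 >= s^2 + gamma r s], while
   [(s + d)^2 <= s^2 + 3 d s] as soon as [d <= s]; hence the factor 1/3 in [d]. *)
have d_b : d <= Num.sqrt (beta 0%N) by rewrite ge_min lexx.
have d_g : d * 3 <= gamma * r by rewrite -ler_pdivlMr// ge_min lexx orbT.
exists d => //; elim=> [|k IH]; first by rewrite mulr1.
have dk : d <= Num.sqrt (beta k).
  by apply: le_trans IH; rewrite (ler_peMr (ltW d0))// ler1n.
rewrite -natr1 mulrDr mulr1; apply: le_trans (_ : Num.sqrt (beta k) + d <= _).
  by rewrite lerD2r.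
rewrite -ler_sqr ?nnegrE ?sqrtr_ge0//; last by rewrite addr_ge0 ?sqrtr_ge0// ltW.
rewrite sE betaS -{2}(sE k).
have := Hr k; move: (Num.sqrt (beta k)) (s0 k) dk => s {}s0 dk Hrk.
have H1 := ler_wpM2r (ltW s0) (ler_wpM2l (ltW gamma0) Hrk).
have H2 := ler_wpM2r (ltW s0) d_g.
have H3 := ler_wpM2l (ltW d0) dk.
lra.
Qed.

(** * Real-valued gaps and the one-step energy descent *)

Definition gap_x (R : realType) (X Y : vectType R) (ipX : inner_product X)
  (Ks : Y -> X) (g : X -> R) xh yh x := g x - g xh + ipX (Ks yh) (x - xh).

Definition gap_y (R : realType) (X Y : vectType R) (ipY : inner_product Y)
  (K : X -> Y) (fs : Y -> R) xh yh y := fs y - fs yh - ipY (K xh) (y - yh).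

Section Descent.
Variables (R : realType) (X Y : vectType R).
Variables (ipX : inner_product X) (ipY : inner_product Y).
Variables (K : {linear X -> Y}) (Ks : {linear Y -> X}).
Hypothesis hK : is_adjoint ipX ipY K Ks.
Variables (g : X -> R) (fs : Y -> R) (xh : X) (yh : Y).

Local Notation P := (gap_x ipX Ks g xh yh).
Local Notation D := (gap_y ipY K fs xh yh).
Definition lyapunov (b : R) (x : X) (y : Y) :=
  b / 2 * ipX (x - xh) (x - xh) + 2^-1 * ipY (y - yh) (y - yh).

(* Cauchy-Schwarz, the stopping rule of the linesearch and AM-GM *)
Lemma coupling_le b t y yn (u : X) : 0 < b -> 0 <= t ->
  ls_stop ipX ipY Ks b y t yn ->
  b * t * ipX (Ks yn - Ks y) u <=
    2^-1 * ipY (yn - y) (yn - y) + b / 2 * ipX u u.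
Proof.
move=> b0 t0; rewrite /ls_stop -(ipnorm_sqr ipX u) -(ipnorm_sqr ipY (yn - y)).
move: (ipX _ u) (ip_le_norm ipX (Ks yn - Ks y) u) (ipnorm_ge0 ipX u) => c.
move: (ipnorm ipX (Ks yn - Ks y)) (ipnorm ipX u) (ipnorm ipY (yn - y)).
move=> a e d cae e0 stop.
have s0 : 0 < Num.sqrt b by rewrite sqrtr_gt0.
have bE : b = Num.sqrt b ^+ 2 by rewrite sqr_sqrtr ?ltW.
move: (Num.sqrt b) s0 bE stop => s s0 -> stop.
have H1 : s ^+ 2 * t * c <= s ^+ 2 * t * (a * e).
  by rewrite ler_wpM2l// mulr_ge0// sqr_ge0.
have H2 := ler_wpM2r (mulr_ge0 (ltW s0) e0) stop.
have := sqr_ge0 (d - s * e); lra.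
Qed.

Lemma lyapunov_descent (gamma b taum tau theta : R) xm x xn xb y yn :
  0 < b -> 0 < taum -> 0 < theta -> tau = theta * taum ->
  xb = x + theta *: (x - xm) ->
  ipX (xm - taum *: Ks y - x) (xn - x) <= taum * (g xn - g x) ->
  ipX (xm - taum *: Ks y - x) (xm - x) <= taum * (g xm - g x) ->
  ipX (x - tau *: Ks yn - xn) (xh - xn)
    + tau * (gamma / 2 * ipX (xh - xn) (xh - xn)) <= tau * (g xh - g xn) ->
  ipY (y + (b * tau) *: K xb - yn) (yh - yn) <= b * tau * (fs yh - fs yn) ->
  ls_stop ipX ipY Ks b y tau yn ->
  lyapunov (b * (1 + gamma * tau)) xn yn
    + b * tau * ((1 + theta) * P x - theta * P xm + D yn)
    <= lyapunov b x y.
Proof.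
move=> b0 taum0 theta0 tauE xbE Hn Hm Hh Hy stop.
have tau0 : 0 <= tau by rewrite tauE mulr_ge0 ?ltW.
have Hc := coupling_le (xb - xn) b0 tau0 stop.
(* The multipliers [b theta], [b theta^2] and [b] give all three right-hand sides a factor [b tau].
   Since [xn - xb = (xn - x) + theta (xm - x)], the first two combine into one inequality in the
   direction [xn - xb]. *)
have {}Hn := ler_wpM2l (mulr_ge0 (ltW b0) (ltW theta0)) Hn.
have {}Hm := ler_wpM2l (mulr_ge0 (mulr_ge0 (ltW b0) (ltW theta0)) (ltW theta0)) Hm.
have {}Hh := ler_wpM2l (ltW b0) Hh.
(* This is the square of [xb - x]. By polarization the squares of [xn - x] cancel, that of [xb - xn]
   absorbs the coupling term, and this one is dropped. *)
have Hs := mulr_ge0 (ltW b0) (ip_ge0 ipX (theta *: (x - xm))).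
rewrite /lyapunov /gap_x /gap_y {stop}; subst tau xb.
move: Hn Hm Hh Hy Hc Hs.
rewrite !(ipDl, ipBl, ipNl, ipZl, ipDr, ipBr, ipNr, ipZr) !hK.
rewrite !(ipDl, ipBl, ipZl) !(ipC ipX _ (Ks _)).
rewrite (ipC ipX xn x) (ipC ipX x xm) (ipC ipX xn xm) (ipC ipX xn xh) (ipC ipX x xh).
rewrite (ipC ipY yn y) (ipC ipY yh y) (ipC ipY yh yn).
lra.
Qed.
End Descent.

(** * Summation of the descent and Jensen's inequality for the weighted averages *)

Lemma convex_on_addl (R : realType) (V : vectType R) (D : set V) (phi l : V -> R) :
  (forall u v t, l (t *: u + (1 - t) *: v) = t * l u + (1 - t) * l v) ->
  convex_on D phi -> convex_on D (fun u => phi u + l u).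
Proof.
move=> lE cD u v t Du Dv t01; have [D' H] := cD u v t Du Dv t01.
by split=> //; rewrite lE; lra.
Qed.

Section ErgodicAverages.
Variables (R : realType) (X Y : vectType R).
Variables (x xb : nat -> X) (y : nat -> Y) (tau theta beta : nat -> R).
Variables (DX : set X) (DY : set Y) (P : X -> R) (D : Y -> R) (A : nat -> R).
Local Notation sigma := (sigma tau beta).
Local Notation ssum := (sigma_sum tau beta).
Let weight N := sigma 1 * theta 1 + ssum N.
Let xsum N := (sigma 1 * theta 1) *: x 0%N + \sum_(1 <= k < N.+1) sigma k *: xb k.
Let ysum N := \sum_(1 <= k < N.+1) sigma k *: y k.+1.
Hypotheses (convP : convex_on DX P) (convD : convex_on DY D).
Hypotheses (xD : forall k, DX (x k.+1)) (yD : forall k, DY (y k.+2)).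
Hypothesis xbE : forall k, xb k.+1 = x k.+1 + theta k.+1 *: (x k.+1 - x k).
Hypotheses (sigma_ge0 : forall k, 0 <= sigma k) (theta_ge0 : forall k, 0 <= theta k).
Hypothesis sigma_theta : forall k, sigma k.+1 * theta k.+1 <= sigma k * (1 + theta k).
Hypothesis descent : forall k,
  A k.+3 + sigma k.+2 * ((1 + theta k.+2) * P (x k.+2)
    - theta k.+2 * P (x k.+1) + D (y k.+3)) <= A k.+2.

(* The weight of x_k in xsum is sigma_k (1 + theta_k) - sigma_(k+1) theta_(k+1),
   which is nonnegative, except for the last index, where the subtracted term is
   missing; in particular x_0, which may lie outside the domain, has weight 0. *)
Lemma ergodic_epi : exists C, forall N, exists bP bD,
  [/\ perspective_epi DX P (weight N.+1 - sigma N.+2 * theta N.+2)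
        (xsum N.+1 - (sigma N.+2 * theta N.+2) *: x N.+1) bP,
      perspective_epi DY D (ssum N.+1) (ysum N.+1) bD &
      bP + sigma N.+2 * theta N.+2 * P (x N.+1) + bD + A N.+2 <= C].
Proof.
pose a k := sigma k * (1 + theta k) - sigma k.+1 * theta k.+1.
have a0 k : 0 <= a k by rewrite subr_ge0.
have xbxE k : sigma k.+1 *: xb k.+1 - (sigma k.+2 * theta k.+2) *: x k.+1 =
    a k.+1 *: x k.+1 - (sigma k.+1 * theta k.+1) *: x k.
  rewrite xbE /a scalerBl scalerDr scalerA scalerBr mulrDr mulr1 scalerDl.
  by rewrite addrA [LHS]addrAC.
(* The value for which the base case is an equality; it involves no gap at [x 0]. *)
exists (sigma 1 * (1 + theta 1) * P (x 1%N) + sigma 1 * D (y 2%N) + A 2%N).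
elim=> [|N [bP [bD [HP HD HC]]]].
  exists (a 1%N * P (x 1%N)), (sigma 1 * D (y 2%N)); split.
  - rewrite /weight /xsum /sigma_sum !big_nat1.
    rewrite (_ : _ + _ - _ = a 1%N); last by rewrite /a; lra.
    rewrite -addrA xbxE addrC subrK.
    exact: perspective_epiZ.
  - by rewrite /ysum /sigma_sum !big_nat1; exact: perspective_epiZ.
  - by rewrite /a; lra.
exists (bP + a N.+2 * P (x N.+2)), (bD + sigma N.+2 * D (y N.+3)); split.
- have := perspective_epiD convP HP (perspective_epiZ P (a0 N.+2) (xD N.+1)).
  rewrite (_ : weight _ - _ + _ = weight N.+2 - sigma N.+3 * theta N.+3); last first.
    rewrite /weight /sigma_sum [in RHS](big_nat_recr N.+2)//= /a; lra.
  congr perspective_epi; rewrite /xsum [in RHS](big_nat_recr N.+2)//=.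
  by rewrite addrA -[RHS]addrA xbxE [RHS]addrA addrAC.
- have := perspective_epiD convD HD (perspective_epiZ D (sigma_ge0 N.+2) (yD N.+1)).
  by rewrite /ysum /sigma_sum !(big_nat_recr N.+2).
- by have := descent N; rewrite /a; lra.
Qed.

(** Adding back the last iterate with its missing weight completes [xsum]. The points [v] and [w]
    are the averages before normalization is divided out, now known to lie in the domains. *)
Lemma ergodic_gap : exists C, forall N, exists v w,
  [/\ DX v, xsum N.+1 = weight N.+1 *: v, DY w, ysum N.+1 = ssum N.+1 *: w &
      weight N.+1 * P v + ssum N.+1 * D w + A N.+2 <= C].
Proof.
have [C HC] := ergodic_epi; exists C => N.
have [bP [bD [HP [_ [w [Dw ysE HD]]] Hle]]] := HC N.
have st0 : 0 <= sigma N.+2 * theta N.+2 by exact: mulr_ge0.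
have := perspective_epiD convP HP (perspective_epiZ P st0 (xD N)).
rewrite !subrK => -[_ [v [Dv xsE HPv]]].
by exists v, w; split=> //; lra.
Qed.

End ErgodicAverages.

(** * Application to the algorithm and convergence rates *)

Lemma primal_gapE (R : realType) (X Y : vectType R) (ipX : inner_product X)
    (Ks : Y -> X) (g : X -> \bar R) xh yh x :
  proper_fun g -> effdom g xh -> effdom g x ->
  primal_gap ipX Ks g xh yh x = (gap_x ipX Ks (fine \o g) xh yh x)%:E.
Proof.
move=> gp gxh gx.
by rewrite /primal_gap (effdomE gp gxh) (effdomE gp gx) -EFinB -EFinD.
Qed.

Lemma dual_gapE (R : realType) (X Y : vectType R) (ipY : inner_product Y)
    (K : X -> Y) (fs : Y -> \bar R) xh yh y :
  proper_fun fs -> effdom fs yh -> effdom fs y ->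
  dual_gap ipY K fs xh yh y = (gap_y ipY K (fine \o fs) xh yh y)%:E.
Proof.
move=> fp fyh fy.
by rewrite /dual_gap (effdomE fp fyh) (effdomE fp fy) -!EFinB.
Qed.

Section Rates.
Variables (R : realType) (X Y : vectType R).
Variables (ipX : inner_product X) (ipY : inner_product Y).
Variables (K : {linear X -> Y}) (Ks : {linear Y -> X}).
Variables (g : X -> \bar R) (fs : Y -> \bar R) (gamma mu : R).
Variables (x xb : nat -> X) (y : nat -> Y) (tau theta beta : nat -> R).
Variables (xh : X) (yh : Y).
Hypotheses (hK : is_adjoint ipX ipY K Ks).
Hypotheses (g_proper : proper_fun g) (g_cvx : cvx g).
Hypotheses (fs_proper : proper_fun fs) (fs_cvx : cvx fs).
Hypotheses (gamma_gt0 : 0 < gamma) (g_sc : strongly_convex ipX gamma g).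
Hypotheses (mu01 : 0 < mu < 1).
Hypothesis hseq :
  apdal_sequence ipX ipY K Ks g fs gamma mu x xb y tau theta beta.
Hypothesis hsaddle : saddle_point ipX ipY K Ks g fs xh yh.

(** The induction is joint: [beta k.+1] needs the sign of [tau k], and the linesearch producing
    [tau k.+1] needs that of [beta k.+1]. *)
Lemma tau_beta_gt0 k : 0 < tau k /\ 0 < beta k.
Proof.
have [L L0 HL] := linear_le_norm ipX ipY Ks.
elim: k => [|k [tk bk]].
  by split; [exact: apdal_tau0 hseq|exact: apdal_beta0 hseq].
have bk1 : 0 < beta k.+1.
  by rewrite (apdal_beta hseq) mulr_gt0// ltr_wpDr// mulr_ge0 ?ltW.
have [t [/andP[t0 _] Hls]] := apdal_linesearch hseq k.
have {}t0 : 0 < t.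
  by apply: lt_le_trans t0; rewrite mulr_gt0// sqrtr_gt0 divr_gt0.
by have [] := linesearchP mu01 L0 HL (linearB Ks) bk1 t0 Hls.
Qed.

Let tau_gt0 k : 0 < tau k := (tau_beta_gt0 k).1.
Let beta_gt0 k : 0 < beta k := (tau_beta_gt0 k).2.

(** Backtracking only shrinks the trial value, so the upper endpoint of the trial interval still
    bounds the accepted one. *)
Lemma apdal_accepted k :
  [/\ tau k.+1 <= tau k * Num.sqrt (beta k / beta k.+1 * (1 + theta k)),
      ls_candidate ipY K fs (tau k) (beta k.+1) (x k) (x k.+1) (y k.+1)
        (tau k.+1) (theta k.+1) (xb k.+1) (y k.+2) &
      ls_stop ipX ipY Ks (beta k.+1) (y k.+1) (tau k.+1) (y k.+2)].
Proof.
have [L L0 HL] := linear_le_norm ipX ipY Ks.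
have [t [/andP[tl tu] Hls]] := apdal_linesearch hseq k.
have t0 : 0 < t.
  by apply: lt_le_trans tl; rewrite mulr_gt0// sqrtr_gt0 divr_gt0.
have [_ tt cand stop _] := linesearchP mu01 L0 HL (linearB Ks) (beta_gt0 k.+1) t0 Hls.
by split=> //; exact: le_trans tt tu.
Qed.

Lemma sqrt_beta_tau_lower : exists2 r, 0 < r &
  forall k, r <= Num.sqrt (beta k) * tau k.
Proof.
have [L L0 HL] := linear_le_norm ipX ipY Ks.
apply: (@step_lower_bound _ _ _ (mu / L)) => //.
  by case/andP: mu01 => mu0 _; rewrite divr_gt0.
move=> k; have [t [/andP[tl _] Hls]] := apdal_linesearch hseq k.
have t0 : 0 < t.
  by apply: lt_le_trans tl; rewrite mulr_gt0// sqrtr_gt0 divr_gt0.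
have [_ _ _ _ []] := linesearchP mu01 L0 HL (linearB Ks) (beta_gt0 k.+1) t0 Hls.
  by move=> ->; left.
by right.
Qed.

Lemma thetaE k : theta k.+1 = tau k.+1 / tau k.
Proof. by have [_ [? _ _] _] := apdal_accepted k. Qed.

Lemma theta_gt0 k : 0 < theta k.
Proof.
by case: k => [|k]; [rewrite (apdal_theta0 hseq)|rewrite thetaE divr_gt0].
Qed.

Lemma xbE k : xb k.+1 = x k.+1 + theta k.+1 *: (x k.+1 - x k).
Proof. by have [_ [_ ? _] _] := apdal_accepted k. Qed.

Lemma sigma_gt0 k : 0 < sigma tau beta k.
Proof. by rewrite mulr_gt0. Qed.

(** This is the squared upper bound on [tau k.+1], multiplied by [beta k.+1 / tau k]. It makes the
    weights of the iterates in the primal average nonnegative, as Jensen's inequality requires. *)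
Lemma sigma_theta_le k : sigma tau beta k.+1 * theta k.+1 <=
  sigma tau beta k * (1 + theta k).
Proof.
have [tu _ _] := apdal_accepted k.
have th0 := theta_gt0 k; have := tau_gt0 k.
have q0 : 0 <= beta k / beta k.+1 * (1 + theta k).
  by rewrite mulr_ge0 ?divr_ge0 ?ltW// addr_gt0.
have {tu} : tau k.+1 ^+ 2 <= (tau k * Num.sqrt (beta k / beta k.+1 * (1 + theta k))) ^+ 2.
  by rewrite ler_sqr// nnegrE ?mulr_ge0 ?sqrtr_ge0 ?ltW.
rewrite exprMn sqr_sqrtr// thetaE /sigma => tu tk.
rewrite -(ler_pM2l (divr_gt0 tk (beta_gt0 k.+1))).
apply: le_trans (_ : tau k.+1 ^+ 2 <= _).
  by rewrite le_eqVlt; apply/orP; left; apply/eqP; field; rewrite !gt_eqF.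
apply: le_trans tu _.
by rewrite le_eqVlt; apply/orP; left; apply/eqP; field; rewrite gt_eqF.
Qed.

Lemma x_effdom k : effdom g (x k.+1).
Proof. by have [] := prox_variational g_proper g_cvx (tau_gt0 k) (apdal_x hseq k). Qed.

Lemma y_effdom k : effdom fs (y k.+2).
Proof.
have [_ [_ _ py] _] := apdal_accepted k.
by have [] := prox_variational fs_proper fs_cvx (sigma_gt0 k.+1) py.
Qed.

Let P := gap_x ipX Ks (fine \o g) xh yh.
Let D := gap_y ipY K (fine \o fs) xh yh.
Let A k := lyapunov ipX ipY xh yh (beta k) (x k) (y k).

Lemma apdal_descent k : A k.+3 + sigma tau beta k.+2 *
  ((1 + theta k.+2) * P (x k.+2) - theta k.+2 * P (x k.+1) + D (y k.+3)) <= A k.+2.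
Proof.
have [gxh fyh _ _] := hsaddle.
have [_ [thE xE py] stop] := apdal_accepted k.+1.
have px1 := apdal_x hseq k.+1; have px2 := apdal_x hseq k.+2.
have [_ vx1] := prox_variational g_proper g_cvx (tau_gt0 k.+1) px1.
have sx2 := prox_strongly_convex g_proper g_cvx g_sc (tau_gt0 k.+2) px2.
have [_ vy] := prox_variational fs_proper fs_cvx (sigma_gt0 k.+2) py.
rewrite /A (apdal_beta hseq k.+2).
apply: (lyapunov_descent hK (xb := xb k.+2) (taum := tau k.+1)) => //.
- exact: theta_gt0.
- by rewrite thE divfK ?gt_eqF.
- exact/vx1/x_effdom.
- exact/vx1/x_effdom.
- exact: sx2.
- exact: vy.
Qed.

Lemma convex_gap_x : convex_on (effdom g) P.
Proof.
have := convex_on_addl _ (cvx_convex_on g_proper g_cvx).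
move=> /(_ (fun u => ipX (Ks yh) (u - xh) - fine (g xh))) H.
suff -> : P = fun u => (fine \o g) u + (ipX (Ks yh) (u - xh) - fine (g xh)).
  by apply: H => u v t; rewrite !(ipBr, ipDr, ipZr); ring.
by apply/funext => u; rewrite /P /gap_x /=; ring.
Qed.

Lemma convex_gap_y : convex_on (effdom fs) D.
Proof.
have := convex_on_addl _ (cvx_convex_on fs_proper fs_cvx).
move=> /(_ (fun u => - ipY (K xh) (u - yh) - fine (fs yh))) H.
suff -> : D = fun u => (fine \o fs) u + (- ipY (K xh) (u - yh) - fine (fs yh)).
  by apply: H => u v t; rewrite !(ipBr, ipDr, ipZr); ring.
by apply/funext => u; rewrite /D /gap_y /=; ring.
Qed.

(** Each [sigma k] is the product of [Num.sqrt (beta k)], which grows linearly, and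
    [Num.sqrt (beta k) * tau k], which is bounded below. *)
Lemma sigma_sum_lower : exists2 d, 0 < d &
  (forall N, d * N%:R <= Num.sqrt (beta N)) /\
  (forall N, d * N%:R ^+ 2 <= sigma_sum tau beta N).
Proof.
have [r r0 Hr] := sqrt_beta_tau_lower.
have [d d0 Hd] := sqrt_linear_growth gamma_gt0 r0 beta_gt0 tau_gt0 Hr (apdal_beta hseq).
have sle k : d * r * k.+1%:R <= sigma tau beta k.
  have := ler_pM (mulr_ge0 (ltW d0) (ler0n R k.+1)) (ltW r0) (Hd k) (Hr k).
  rewrite mulrA -expr2 sqr_sqrtr; last exact/ltW.
  by rewrite /sigma mulrAC.
have dr0 : 0 < d * r by rewrite mulr_gt0.
have q0 : 0 < Num.min d (d * r / 2) by rewrite lt_min d0 divr_gt0.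
have q1 : Num.min d (d * r / 2) <= d by rewrite ge_min lexx.
have q2 : Num.min d (d * r / 2) <= d * r / 2 by rewrite ge_min lexx orbT.
exists (Num.min d (d * r / 2)) => //; split=> N.
  apply: le_trans (Hd N); apply: le_trans (ler_wpM2r (ler0n R N) q1) _.
  by rewrite ler_pM2l// ler_nat.
apply: le_trans (ler_wpM2r (sqr_ge0 _) q2) _.
(* From N to N + 1 the left side grows by [d r (N + 1/2)], which is below the bound [d r (N + 2)]
   for the new term. *)
rewrite /sigma_sum; elim: N => [|N IH]; first by rewrite big_geq// expr0n/= mulr0.
rewrite big_nat_recr//=; apply: le_trans (lerD IH (sle N.+1)).
by rewrite -(natr1 N.+1) -(natr1 N); lra.
Qed.

(** At a saddle point both gaps are nonnegative, so every term of the summed energy inequality is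
    bounded on its own. The index starts at [N.+1] because [sigma_sum] vanishes at 0. *)
Lemma apdal_bounds : exists C, forall N,
  [/\ beta N.+2 * ipX (x N.+2 - xh) (x N.+2 - xh) <= C,
      pd_gap ipX ipY K Ks g fs xh yh (avg_x x xb tau theta beta N.+1)
        (avg_y y tau beta N.+1) \is a fin_num &
      sigma_sum tau beta N.+1 *
        `|fine (pd_gap ipX ipY K Ks g fs xh yh (avg_x x xb tau theta beta N.+1)
           (avg_y y tau beta N.+1))| <= C].
Proof.
have [gxh fyh Pge0 Dge0] := hsaddle.
have [C HC] := ergodic_gap convex_gap_x convex_gap_y x_effdom y_effdom xbE
  (fun k => ltW (sigma_gt0 k)) (fun k => ltW (theta_gt0 k)) sigma_theta_le apdal_descent.
(* The factor 2 undoes the [b / 2] in the energy. *)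
exists (2 * C) => N; have [v [w [gv vE fw wE {}HC]]] := HC N.
have s0 : 0 < sigma_sum tau beta N.+1.
  rewrite /sigma_sum big_nat_recr//= ltr_wpDl ?sigma_gt0// sumr_ge0// => k _.
  exact/ltW/sigma_gt0.
have st0 : 0 <= sigma tau beta 1 * theta 1 by rewrite mulr_ge0 ?ltW ?sigma_gt0 ?theta_gt0.
have W0 : 0 < sigma tau beta 1 * theta 1 + sigma_sum tau beta N.+1.
  by rewrite ltr_wpDl.
rewrite /avg_x vE /avg_y wE !scalerA !mulVf ?gt_eqF// !scale1r.
rewrite /pd_gap (primal_gapE _ _ _ g_proper gxh gv) (dual_gapE _ _ _ fs_proper fyh fw).
have := Pge0 v; rewrite (primal_gapE _ _ _ g_proper gxh gv) lee_fin -/P => Pv.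
have := Dge0 w; rewrite (dual_gapE _ _ _ fs_proper fyh fw) lee_fin -/D => Dw.
rewrite -EFinD [fine _](_ : _ = P v + D w)// (ger0_norm (addr_ge0 Pv Dw)).
have sP := mulr_ge0 (ltW s0) Pv; have sD := mulr_ge0 (ltW s0) Dw.
have stP := mulr_ge0 st0 Pv.
have Ax : 0 <= beta N.+2 / 2 * ipX (x N.+2 - xh) (x N.+2 - xh).
  by rewrite mulr_ge0 ?ip_ge0 ?divr_ge0 ?ltW.
have Ay := ip_ge0 ipY (y N.+2 - yh).
rewrite /A /lyapunov in HC.
by split=> //; lra.
Qed.

End Rates.

Theorem theorem4 (R : realType) (X Y : vectType R)
  (ipX : inner_product X) (ipY : inner_product Y)
  (K : {linear X -> Y}) (Ks : {linear Y -> X})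
  (hK : is_adjoint ipX ipY K Ks)
  (g : X -> \bar R) (f : Y -> \bar R)
  (g_proper : proper_fun g) (g_lsc : lsc ipX g) (g_cvx : cvx g)
  (f_lsc : lsc ipY f) (f_cvx : cvx f)
  (fs_proper : proper_fun (conjugate ipY f))
  (fs_lsc : lsc ipY (conjugate ipY f)) (fs_cvx : cvx (conjugate ipY f))
  (gamma : R) (gamma_gt0 : 0 < gamma) (g_sc : strongly_convex ipX gamma g)
  (mu : R) (mu01 : 0 < mu < 1)
  (x xb : nat -> X) (y : nat -> Y) (tau theta beta : nat -> R)
  (hseq : apdal_sequence ipX ipY K Ks g (conjugate ipY f) gamma mu
            x xb y tau theta beta)
  (xh : X) (yh : Y)
  (hsaddle : saddle_point ipX ipY K Ks g (conjugate ipY f) xh yh) :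
  let XN := avg_x x xb tau theta beta in
  let YN := avg_y y tau beta in
  let G := pd_gap ipX ipY K Ks g (conjugate ipY f) xh yh in
  [/\ (fun N => ipnorm ipX (x N - xh)) =O_\oo (fun N => N%:R^-1 : R),
      \forall N \near \oo, G (XN N) (YN N) \is a fin_num &
      (fun N => fine (G (XN N) (YN N))) =O_\oo (fun N => (N%:R ^+ 2)^-1 : R)].
Proof.
move=> XN YN G.
have [C HC] := apdal_bounds hK g_proper g_cvx fs_proper fs_cvx gamma_gt0 g_sc
  mu01 hseq hsaddle.
have [d d0 [Hd Hs]] := sigma_sum_lower gamma_gt0 mu01 hseq.
have C0 : 0 <= C.
  have [_ _] := HC 0%N; apply: le_trans; rewrite mulr_ge0//.
  by apply: le_trans (Hs 1%N); rewrite mulr_ge0 ?ltW.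
split.
(* [C] may be 0, while the constant of a big-O must be positive; hence [C + 1]. The bound on the
   iterates is available from index 2 on. *)
- apply/eqO_exP; exists (Num.sqrt (C + 1) / d); first by rewrite divr_gt0// sqrtr_gt0; lra.
  exists 2%N => // -[|[|N]]//= _; have [Hx _ _] := HC N.
  rewrite ger0_norm ?ipnorm_ge0// ger0_norm ?invr_ge0// -mulrA -invfM.
  have dN : 0 < d * N.+2%:R by rewrite mulr_gt0.
  rewrite ler_pdivlMr//.
  have := ler_wpM2l (ipnorm_ge0 ipX (x N.+2 - xh)) (Hd N.+2).
  move=> /le_trans; apply; rewrite -sqrtrM ?ip_ge0// ler_wsqrtr//.
  by rewrite mulrC; lra.
- by exists 1%N => // -[|N]//= _; have [] := HC N.
- apply/eqO_exP; exists ((C + 1) / d); first by rewrite divr_gt0//; lra.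
  exists 1%N => // -[|N]//= _; have [_ _ HG] := HC N.
  rewrite [X in _ <= _ * X]ger0_norm ?invr_ge0 ?sqr_ge0// -mulrA -invfM.
  have dN : 0 < d * N.+1%:R ^+ 2 by rewrite mulr_gt0 ?exprn_gt0.
  rewrite ler_pdivlMr//.
  have := ler_wpM2l (normr_ge0 (fine (G (XN N.+1) (YN N.+1)))) (Hs N.+1).
  by move=> /le_trans; apply; rewrite mulrC; apply: le_trans HG _; lra.
Qed.
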